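(* There exists a constant $C>0$ such that for every positive integer $n$ there exist 3-SAT formulas $f$ and $\tilde f$, each with at most $Cn$ variables and at most $Cn$ clauses, such that $f$ is satisfiable, $\tilde f$ is unsatisfiable, and the literal-clause graphs with negation connections $\mathrm{LCN}(f)$ and $\mathrm{LCN}(\tilde f)$ are indistinguishable by the $n$-WL test.
   Context: A literal is a variable $x$ or its negation $\neg x$; a clause is a set of literals (their disjunction); a CNF formula is a set of clauses (their conjunction). A 3-SAT formula is a CNF formula in which every clause has at most 3 literals. For a CNF formula $f$ on variables $x_1,\dots,x_n$, the literal-clause graph with negation connections $\mathrm{LCN}(f)$ is the edge-colored graph, without vertex labels, whose vertices are the $2n$ literals $x_i,\neg x_i$ together with one vertex per clause of $f$; it has an edge of color ''literal-clause'' between a literal $\ell$ and a clause $c$ whenever $\ell\in c$, and an edge of a different color ''literal-literal'' between $x_i$ and $\neg x_i$ for each $i$. $k$-WL test ($k\ge 2$), on edge-colored graphs: the atomic type of a tuple $\bar v=(v_1,\dots,v_k)\in V(G)^k$ is such that two tuples $\bar v\in V(G)^k$, $\bar u\in V(G')^k$ have the same atomic type iff $v_i\mapsto u_i$ is an isomorphism of the induced (vertex- and edge-)colored subgraphs on $\{v_1,\dots,v_k\}$ and $\{u_1,\dots,u_k\}$ (respecting equalities among entries). Initially $\chi^0(\bar v)$ is the atomic type of $\bar v$; then $\chi^\ell(\bar v)=(\chi^{\ell-1}(\bar v),\chi^{\ell-1}_1(\bar v),\dots,\chi^{\ell-1}_k(\bar v))$ with $\chi^{\ell-1}_i(\bar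 v)=\{\!\{\chi^{\ell-1}(v_1,\dots,v_{i-1},u,v_{i+1},\dots,v_k):u\in V\}\!\}$, iterated until the induced partition of $k$-tuples stabilizes. The algorithm is run on the disjoint union of $G$ and $G'$; the test distinguishes $G$ and $G'$ if for some color the numbers of tuples of that color in $V(G)^k$ and in $V(G')^k$ differ; otherwise they are indistinguishable. *)

(* Defs.v *)
From HB Require Import structures.
From mathcomp Require Import all_boot all_order all_algebra.

Set Implicit Arguments.
Unset Strict Implicit.
Unset Printing Implicit Defensive.

(* A literal is a pair (i, b): b = true is x_i, b = false is ~ x_i.   *)
Definition lit (nv : nat) : finType := ('I_nv * bool)%type.

Definition cnf (nv : nat) := {set {set lit nv}}.

Definition lit_true nv (a : {ffun 'I_nv -> bool}) (l : lit nv) : bool :=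
  a l.1 == l.2.

Definition satisfiable nv (f : cnf nv) : Prop :=
  exists a : {ffun 'I_nv -> bool},
    forall c, c \in f -> exists2 l, l \in c & lit_true a l.

Definition is_3SAT nv (f : cnf nv) : Prop := forall c, c \in f -> #|c| <= 3.

(* ecol u v = 0 means no edge; positive values are edge colors.     *)

Record ecgraph := ECGraph { vt : finType; ecol : vt -> vt -> nat }.

Definition LCN_V nv (f : cnf nv) : finType :=
  (lit nv + {c : {set lit nv} | c \in f})%type.

Definition LCN_edge nv (f : cnf nv) (u v : LCN_V f) : nat :=
  match u, v with
  | inl l, inr c => if l \in val c then 1 else 0
  | inr c, inl l => if l \in val c then 1 else 0
  | inl l1, inl l2 => if (l1.1 == l2.1) && (l1.2 != l2.2) then 2 else 0
  | inr _, inr _ => 0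
  end.

Definition LCN nv (f : cnf nv) : ecgraph := @ECGraph (LCN_V f) (@LCN_edge nv f).

(* Colors are represented by the equivalence relation same color at  *)
(* round l on k-tuples of vertices of the disjoint union.            *)

Section WL.
Variables (k : nat) (G1 G2 : ecgraph).

Definition UV : finType := (vt G1 + vt G2)%type.

Definition ecolU (u v : UV) : nat :=
  match u, v with
  | inl a, inl b => ecol a b
  | inr a, inr b => ecol a b
  | _, _ => 0
  end.

Definition ktuple : finType := {ffun 'I_k -> UV}.

(* same atomic type: i |-> j induces an isomorphism of the induced
   edge-colored subgraphs, respecting equalities among entries *)
Definition same_atp (x y : ktuple) : bool :=
  [forall i, forall j,
     ((x i == x j) == (y i == y j)) && (ecolU (x i) (x j) == ecolU (y i) (y j))].

Definition upd (x : ktuple) (i : 'I_k) (u : UV) : ktuple :=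
  [ffun j => if j == i then u else x j].

(* wl_eq l x y  <->  chi^l(x) = chi^l(y).
   chi^(l+1)(x) = chi^(l+1)(y) iff chi^l(x) = chi^l(y) and for every i the
   multisets {{chi^l(x[i<-u]) : u in V}} and {{chi^l(y[i<-u]) : u in V}}
   coincide, i.e. every color class (that of some tuple z) is hit the
   same number of times. *)
Fixpoint wl_eq (l : nat) (x y : ktuple) : bool :=
  match l with
  | 0 => same_atp x y
  | l'.+1 =>
      wl_eq l' x y &&
      [forall i, forall z : ktuple,
         #|[pred u | wl_eq l' (upd x i u) z]| ==
         #|[pred u | wl_eq l' (upd y i u) z]|]
  end.

Definition in_G1 (x : ktuple) : bool := [forall i, if x i is inl _ then true else false].
Definition in_G2 (x : ktuple) : bool := [forall i, if x i is inr _ then true else false].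

Definition wl_stable (l : nat) : Prop := forall x y, wl_eq l x y = wl_eq l.+1 x y.

Definition wl_indistinguishable : Prop :=
  exists L, wl_stable L /\
    forall z : ktuple,
      #|[pred x | in_G1 x && wl_eq L x z]| = #|[pred x | in_G2 x && wl_eq L x z]|.

End WL.

(* Main.v *)
(* Take a system of linear equations over F_2 with three variables per equation
   and one more equation than variables; some right-hand side b makes it
   unsolvable, while 0 is solved by 0. Both systems are written as 3-SAT
   formulas, each equation giving the four clauses that exclude its falsifying
   assignments. Negating a set of variables maps clauses of an equation for 0
   to clauses of the same equation for b exactly when the indicator of that set
   solves the equation for b, so Duplicator survives the bijective pebble game
   as long as a partial assignment on the pebbled variables looks extendable to
   a solution. If every nonempty set S of at most r equations has a sum with
   more than |S|/2 variables, then a partial assignment that respects all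
   consequences of small sets of equations extends to any further variable: two
   small sets that both determine the new value differ by a small set whose sum
   lies on the old variables. Systems with this expansion and r linear in the
   number of variables exist by a union bound. *)

Require Import Defs.
From HB Require Import structures.
From mathcomp Require Import all_boot all_order all_algebra.
From mathcomp Require Import zify.
Import Order.TTheory GRing.Theory Num.Theory.

Set Implicit Arguments.
Unset Strict Implicit.
Unset Printing Implicit Defensive.

(** * Back-and-forth systems for the Weisfeiler-Leman test *)

Section BackAndForth.

Variables (k : nat) (G1 G2 : ecgraph).

Local Notation UV := (UV G1 G2).
Local Notation ktuple := (ktuple k G1 G2).

Definition in_left (u : UV) : bool := if u is inl _ then true else false.

Lemma same_atp_sym (x y : ktuple) : same_atp x y -> same_atp y x.
Proof.
move=> /forallP h; apply/forallP=> i; apply/forallP=> j.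
by case/andP: (forallP (h i) j) => /eqP-> /eqP->; rewrite !eqxx.
Qed.

Lemma same_atp_trans : transitive (@same_atp k G1 G2).
Proof.
move=> y x z /forallP h1 /forallP h2; apply/forallP=> i; apply/forallP=> j.
case/andP: (forallP (h1 i) j) => /eqP-> /eqP->.
by case/andP: (forallP (h2 i) j) => /eqP-> /eqP->; rewrite !eqxx.
Qed.

Lemma wl_eq_sym l (x y : ktuple) : wl_eq l x y = wl_eq l y x.
Proof.
suff h (u v : ktuple) : wl_eq l u v -> wl_eq l v u by apply/idP/idP; apply: h.
elim: l u v => [|l IH] u v /=; first exact: same_atp_sym.
case/andP=> /IH-> /forallP h; apply/forallP=> i; apply/forallP=> z.
by rewrite (eqP (forallP (h i) z)).
Qed.

Lemma wl_eq_trans l : transitive (@wl_eq k G1 G2 l).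
Proof.
elim: l => [|l IH] y x z /=; first exact: same_atp_trans.
case/andP=> xy /forallP h1 /andP[yz /forallP h2]; rewrite (IH _ _ _ xy yz).
apply/forallP=> i; apply/forallP=> w.
by rewrite (eqP (forallP (h1 i) w)) (eqP (forallP (h2 i) w)).
Qed.

(** The relations [wl_eq l] shrink as [l] grows, and the number of related pairs cannot drop
    forever. *)
Lemma wl_stabilizes : exists L, @wl_stable k G1 G2 L.
Proof.
pose E l := [set p : ktuple * ktuple | wl_eq l p.1 p.2].
have sE l : E l.+1 \subset E l.
  by apply/subsetP=> p; rewrite !inE /= => /andP[].
have [L eqL] : exists L, E L = E L.+1.
  suff [L] : exists L, #|E L| <= #|E L.+1|.
    by exists L; apply/esym/eqP; rewrite eqEcard sE.
  have : exists m L, #|E L| <= m by exists #|E 0|, 0.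
  case=> m; elim: m => [|m IH] [L leL].
    by exists L; rewrite (leq_trans leL).
  have [|ltL] := leqP #|E L| #|E L.+1|; first by exists L.
  by apply: IH; exists L.+1; rewrite -ltnS (leq_trans ltL).
exists L => x y; move/setP/(_ (x, y)): eqL.
by rewrite !inE.
Qed.

(** [R] is a set of winning positions for Duplicator: when pebble [i] is lifted, the bijection [s]
    answers every new place [u]. It exchanges the two graphs because tuples of one are to be counted
    against tuples of the other. *)
Variable R : ktuple -> ktuple -> Prop.
Hypothesis R_atp : forall x y, R x y -> same_atp x y.
Hypothesis R_step : forall x y i, R x y -> exists2 s : UV -> UV,
  injective s /\ (forall u, in_left (s u) = ~~ in_left u) &
  forall u, R (upd x i u) (upd y i (s u)).

Lemma R_wl_eq l x y : R x y -> wl_eq l x y.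
Proof.
elim: l x y => [|l IH] x y Rxy /=; first exact: R_atp.
rewrite IH //=; apply/forallP=> i; apply/forallP=> z.
have [s [inj_s _] Rs] := R_step i Rxy.
rewrite -(on_card_preimset (f := s) (R := [pred u | wl_eq l (upd y i u) z])).
  apply/eqP/eq_card=> u; rewrite !inE.
  have xy := IH _ _ (Rs u).
  by apply/idP/idP; apply: wl_eq_trans; rewrite // wl_eq_sym.
by apply: onW_bij; apply: injF_bij.
Qed.

(** Interpolates between the single tuple [x0] at [j = 0] and all tuples inside one graph at
    [j = k]. *)
Let fiber side j (x0 : ktuple) : pred ktuple := fun x =>
  [forall i : 'I_k, if i < j then in_left (x i) == side else x i == x0 i].

Lemma fiber_step side (j : 'I_k) x0 u :
  in_left u = side ->
  forall x, fiber side j (upd x0 j u) x = fiber side j.+1 x0 x && (x j == u).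
Proof.
move=> su x; apply/forallP/andP=> [h|[/forallP h /eqP xj] i].
  have /eqP xj : x j == u by have := h j; rewrite ltnn ffunE eqxx.
  split; last exact/eqP.
  apply/forallP=> i; have := h i; rewrite ltnS ffunE.
  case: ltngtP => [||/val_inj->] //; first by case: (i =P j) => // ->; rewrite ltnn.
  by rewrite xj su !eqxx.
have := h i; rewrite ltnS ffunE.
by case: ltngtP => [||/val_inj->] //; rewrite ?eqxx ?xj //; case: (i =P j) => // ->; rewrite ltnn.
Qed.

(** Induction on [j]: each fiber splits by its last free entry, and [s] matches the pieces on
    opposite sides. At [j = 0] two tuples of equal color remain. *)
Lemma card_fiber L z side j x0 y0 : j <= k -> R x0 y0 ->
  #|[pred x | fiber side j x0 x && wl_eq L x z]|
  = #|[pred y | fiber (~~ side) j y0 y && wl_eq L y z]|.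
Proof.
elim: j x0 y0 => [|j IH] x0 y0 ltj Rxy.
  have fiber0 sd x1 : [pred x | fiber sd 0 x1 x && wl_eq L x z]
      =i [pred x | (x == x1) && wl_eq L x1 z].
    move=> x; rewrite !inE; apply/andP/andP=> [[/forallP h]|[/eqP-> h]].
      by suff -> : x = x1 by []; apply/ffunP=> i; apply/eqP/(h i).
    by split=> //; apply/forallP=> i /=.
  rewrite !(eq_card (fiber0 _ _)).
  have -> : wl_eq L x0 z = wl_eq L y0 z.
    have xy := R_wl_eq L Rxy.
    by apply/idP/idP; apply: wl_eq_trans; rewrite // wl_eq_sym.
  have card_pt (x1 : ktuple) (b : bool) : #|[pred x | (x == x1) && b]| = b.
    case: b; last by rewrite eq_card0 // => x; rewrite unfold_in /= andbF.
    by apply: etrans (card1 x1); apply: eq_card => x; rewrite unfold_in /= andbT.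
  by rewrite !card_pt.
pose J := Ordinal ltj.
have split_fiber sd x1 : #|[pred x | fiber sd j.+1 x1 x && wl_eq L x z]|
    = \sum_(u | in_left u == sd)
         #|[pred x | fiber sd j (upd x1 J u) x && wl_eq L x z]|.
  rewrite -sum1_card (partition_big (fun x : ktuple => x J)
    (fun u => in_left u == sd)) /=.
    apply: eq_bigr => u /eqP su; rewrite -sum1_card; apply: eq_bigl => x.
    by rewrite !inE (fiber_step J x1 su) andbAC.
  by move=> x; rewrite !inE => /andP[/forallP/(_ J)]; rewrite ltnS leqnn.
have [s [inj_s side_s] Rs] := R_step J Rxy.
rewrite !split_fiber [RHS](reindex s) /=; last exact/onW_bij/injF_bij.
apply: eq_big => [u|u _]; first by rewrite side_s; case: (in_left u); case: (side).
exact/IH/Rs/ltnW.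
Qed.

Lemma back_and_forth_indistinguishable :
  (exists x y, R x y) -> wl_indistinguishable k G1 G2.
Proof.
move=> [x0 [y0 Rxy]]; have [L stL] := wl_stabilizes.
exists L; split=> // z.
have := card_fiber L z true (leqnn k) Rxy.
rewrite (eq_card (B := [pred x | in_G1 x && wl_eq L x z])) => [->|x].
  apply: eq_card => x; rewrite !inE; congr (_ && _).
  by apply: eq_forallb => i; rewrite ltn_ord; case: (x i).
rewrite !inE; congr (_ && _).
by apply: eq_forallb => i; rewrite ltn_ord; case: (x i).
Qed.

End BackAndForth.

(** * Expanding systems of equations *)

Section Expansion.

Variables (E V : finType) (A : E -> {set V}).

(* Support of the sum over F_2 of the equations of S. *)
Definition odd_support (S : {set E}) : {set V} :=
  [set v | odd #|[set e in S | v \in A e]|].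

(** Double counting of incidences: a covered variable outside the odd support lies in at least two
    equations of [S], one inside it in at least one. *)
Lemma card_cover_odd_support (S : {set E}) : (forall e, #|A e| = 3) ->
  2 * #|\bigcup_(e in S) A e| <= 3 * #|S| + #|odd_support S|.
Proof.
move=> cardA.
have -> : 3 * #|S| = \sum_v #|[set e in S | v \in A e]|.
  transitivity (\sum_(e in S) \sum_(v in A e) 1).
    by under eq_bigr do rewrite sum1_card cardA; rewrite sum_nat_const mulnC.
  rewrite (exchange_big_dep predT) //=; apply: eq_bigr => v _.
  by rewrite -sum1_card; apply: eq_bigl => e; rewrite inE.
have -> : #|odd_support S| = \sum_v (v \in odd_support S).
  by rewrite -sum1_card big_mkcond; apply: eq_bigr => v _; case: ifP.
rewrite -big_split /=.
rewrite -sum1_card big_distrr /= [X in X <= _]big_mkcond /=.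
apply: leq_sum => v _; case: ifP => // /bigcupP[e eS vA].
have : 0 < #|[set e in S | v \in A e]|.
  by apply/card_gt0P; exists e; rewrite inE eS.
rewrite inE; case: #|_| => // -[|d] //= _; lia.
Qed.

End Expansion.

(** * Numerical estimates for the union bound *)

Lemma expn_le_fact s : s ^ s <= 4 ^ s * s`!.
Proof.
have h j : j <= s -> s ^ j <= (2 * s) ^_ j.
  elim: j => [|j IH] js; first by rewrite ffactn0.
  by rewrite expnSr ffactnSr leq_mul ?IH; lia.
(* It remains to bound ['C(2 * s, s)] by the number [4 ^ s] of all subsets of [2 * s] points. *)
apply: leq_trans (h s (leqnn s)) _; rewrite -bin_ffact leq_mul2r.
have -> : 4 ^ s = 2 ^ (2 * s) by rewrite expnM.
rewrite -[X in 'C(X, _)](card_ord (2 * s)) -card_draws.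
apply/orP; right; apply: leq_trans (max_card _) _.
by rewrite -cardsT -powersetT card_powerset cardsT card_ord.
Qed.

Lemma bin_expn_le n s : 'C(n, s) * s ^ s <= (4 * n) ^ s.
Proof.
have h : n ^_ s <= n ^ s.
  elim: s => [|s IH]; first by rewrite ffactn0.
  by rewrite expnSr ffactnSr leq_mul // leq_subr.
apply: leq_trans (leq_mul (leqnn _) (expn_le_fact s)) _.
by rewrite mulnCA bin_ffact expnMn leq_mul2l h orbT.
Qed.

(* A set of s equations whose sum has at most s / 2 variables involves at most
   t = (3 s + s / 2) / 2 = 7 s / 4 variables. The left-hand side, up to the
   factor N ^ (3 (m - s)), is 2 ^ s times the number of systems in which some
   s equations have all their variables among t. *)
Lemma union_bound_term N s t : 0 < s -> 4 * t <= 7 * s -> 2 ^ 56 * s <= N ->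
  2 ^ s * ('C((3 * N).+1, s) * ('C(3 * N, t) * t ^ (3 * s))) <= N ^ (3 * s).
Proof.
(* An opaque name for the exponent keeps [2 ^ 56] unevaluated. *)
have [c ceq] : exists c, c = 56 by exists 56.
rewrite -ceq => s0 ts sN.
have N0 : 0 < N by apply: leq_trans sN; rewrite muln_gt0 expn_gt0.
(* The exponent [3 * s] exceeds [s + t] by [a], and [4 * a >= s]. The surplus [N ^ a] pays for all
   constants, since [56 * a >= 14 * s]. *)
pose a := 2 * s - t.
have B1 : 'C((3 * N).+1, s) * s ^ s <= (16 * N) ^ s.
  by apply: leq_trans (bin_expn_le _ _) _; rewrite leq_exp2r //; lia.
have B2 : 'C(3 * N, t) * t ^ t <= (16 * N) ^ t.
  apply: leq_trans (bin_expn_le _ _) _.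
  by case: (t) => // t'; rewrite leq_exp2r //; lia.
have B3 : t ^ (s + a) <= (2 * s) ^ (s + a).
  by rewrite leq_exp2r; lia.
have B4 : 2 ^ (14 * s) * s ^ a <= N ^ a.
  apply: (@leq_trans ((2 ^ c * s) ^ a)); last by rewrite leq_exp2r //; lia.
  rewrite expnMn leq_mul2r; apply/orP; right.
  by rewrite -expnM leq_exp2l //; nia.
rewrite -(leq_pmul2r (_ : 0 < s ^ s)); last by rewrite expn_gt0 s0.
have -> : t ^ (3 * s) = t ^ t * t ^ (s + a) by rewrite -expnD; congr (_ ^ _); lia.
have -> : N ^ (3 * s) = N ^ (s + t) * N ^ a by rewrite -expnD; congr (_ ^ _); lia.
have := leq_mul (leqnn (2 ^ s)) (leq_mul (leq_mul B1 B2) B3).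
set x := 'C(_, s); set y := 'C(_, t) => le1.
have -> : 2 ^ s * (x * (y * (t ^ t * t ^ (s + a)))) * s ^ s =
  2 ^ s * (x * s ^ s * (y * t ^ t) * t ^ (s + a)) by lia.
apply: leq_trans le1 _.
rewrite -expnD !expnMn (_ : 16 = 2 ^ 4) // -expnM.
have -> : 2 ^ s * (2 ^ (4 * (s + t)) * N ^ (s + t) * (2 ^ (s + a) * s ^ (s + a)))
   = 2 ^ (s + 4 * (s + t) + (s + a)) * (N ^ (s + t) * s ^ a) * s ^ s.
  by rewrite !expnD; lia.
rewrite leq_mul2r; apply/orP; right.
(* The exponent of 2 equals [8 * s + 3 * t], which is at most [14 * s] because [4 * t <= 7 * s]. *)
apply: (@leq_trans (2 ^ (14 * s) * (N ^ (s + t) * s ^ a))).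
  by rewrite leq_mul2r; apply/orP; right; rewrite leq_exp2l //; lia.
by rewrite mulnCA leq_mul2l B4 orbT.
Qed.

(** Each [a s] is at most [T / 2 ^ s], and these bounds add up to [T - T / 2 ^ r]. *)
Lemma geometric_sum_lt r T (a : nat -> nat) : 0 < T ->
  (forall s, 0 < s -> s <= r -> 2 ^ s * a s <= T) -> \sum_(1 <= s < r.+1) a s < T.
Proof.
move=> T0 le_a; suff : 2 ^ r * \sum_(1 <= s < r.+1) a s + T <= 2 ^ r * T.
  by have := expn_gt0 2 r; nia.
elim: r le_a => [|r IH] le_a; first by rewrite big_geq ?muln0 ?mul1n.
rewrite big_nat_recr //= mulnDr expnS.
have := IH (fun s s0 sr => le_a s s0 (leqW sr)); have := le_a r.+1 isT (leqnn _).
rewrite expnS; lia.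
Qed.

Lemma card_bigcup_le (I T : finType) (P : pred I) (F : I -> {set T}) :
  #|\bigcup_(i | P i) F i| <= \sum_(i | P i) #|F i|.
Proof.
elim/big_rec2: _ => [|i n B _ le_Bn]; first by rewrite cards0.
by apply: leq_trans (leq_card_setU _ _) _; rewrite leq_add2l.
Qed.

Lemma superset_of_card (T : finType) (B : {set T}) t :
  #|B| <= t -> t <= #|T| -> exists2 U : {set T}, B \subset U & #|U| = t.
Proof.
move=> Bt tT; have /card_geqP[s [us ss sB]] : t - #|B| <= #|~: B|.
  by rewrite [X in _ <= X]cardsCs setCK leq_sub2r.
exists (B :|: [set:: s]); first exact: subsetUl.
rewrite cardsU (_ : _ :&: _ = set0) ?cards0.
  by rewrite cardsE (card_uniqP us) ss; lia.
apply/setP=> x; rewrite !inE; case: (boolP (x \in s)) => [/sB|]; last by rewrite andbF.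
by rewrite inE andbT => /negPf.
Qed.

(* The j-th variable of an equation is drawn from the j-th of three disjoint
   blocks of N variables, so the three variables are always distinct. *)
Section RandomSystem.

Variables (N m : nat).

Local Notation V := 'I_(3 * N).

Definition block_var (p : 'I_3 * 'I_N) : V := mxvec_index p.1 p.2.

Lemma block_var_inj : injective block_var.
Proof.
apply: (eq_inj (f := uncurry (@mxvec_index 3 N))); last by case.
exact/bij_inj/onT_bij/curry_mxvec_bij.
Qed.

Implicit Types f : {ffun 'I_m * 'I_3 -> 'I_N}.

Definition random_eqs f (e : 'I_m) : {set V} :=
  [set block_var (j, f (e, j)) | j : 'I_3].

Lemma card_random_eqs f e : #|random_eqs f e| = 3.
Proof. by rewrite card_imset ?card_ord // => j j' /block_var_inj[]. Qed.

(** A choice for an equation of [S] must land in [U], which by injectivity of [block_var] leaves at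
    most [#|U|] values; the choices for other equations are free. *)
Lemma card_eqs_within (S : {set 'I_m}) (U : {set V}) :
  #|[set f | [forall e in S, random_eqs f e \subset U]]|
    <= #|U| ^ (3 * #|S|) * N ^ (3 * (m - #|S|)).
Proof.
pose F (p : 'I_m * 'I_3) : pred 'I_N :=
  fun a => (p.1 \in S) ==> (block_var (p.2, a) \in U).
apply: (@leq_trans #|family F|).
  apply/subset_leq_card/subsetP=> f; rewrite inE => /forall_inP sub_f.
  apply/familyP=> -[e j]; apply/implyP=> /= /sub_f/subsetP; apply.
  exact: imset_f.
rewrite card_family foldrE big_map big_enum /=.
apply: (@leq_trans (\prod_(p : 'I_m * 'I_3) if p.1 \in S then #|U| else N)).
  apply: leq_prod => -[e j] _; rewrite /F /=; case: (e \in S) => /=.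
    rewrite -[X in X <= _](card_imset (f := fun a => block_var (j, a))).
      by apply/subset_leq_card/subsetP=> _ /imsetP[a aU ->].
    by move=> a a' /block_var_inj[].
  by apply: leq_trans (max_card _) _; rewrite card_ord.
have cardX (B : {set 'I_m}) : #|[pred p : 'I_m * 'I_3 | p.1 \in B]| = 3 * #|B|.
  transitivity #|setX B [set: 'I_3]|; last by rewrite cardsX cardsT card_ord mulnC.
  by apply: eq_card => p; rewrite !inE andbT.
rewrite (bigID (fun p : 'I_m * 'I_3 => p.1 \in S)) /=.
rewrite (eq_bigr (fun=> #|U|)) => [|p ->] //.
rewrite (eq_bigr (fun=> N) (P := fun p => p.1 \notin S)) => [|p /negPf->] //.
rewrite !prod_nat_const cardX leq_mul2l; apply/orP; right.
suff -> : #|[pred p : 'I_m * 'I_3 | p.1 \notin S]| = 3 * (m - #|S|) by [].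
have -> : m - #|S| = #|~: S| by rewrite [RHS]cardsCs setCK card_ord.
by rewrite -cardX; apply: eq_card => p; rewrite !inE.
Qed.

End RandomSystem.

Lemma expanding_system : exists2 D, 0 < D & forall r, 0 < r ->
  exists A : 'I_(3 * (D * r)).+1 -> {set 'I_(3 * (D * r))},
    (forall e, #|A e| = 3) /\
    (forall S, S != set0 -> #|S| <= r -> #|S| < 2 * #|odd_support A S|).
Proof.
pose D := 2 ^ 56; exists D => [|r r0]; first by rewrite expn_gt0.
have le_rN : r <= D * r by rewrite leq_pmull // expn_gt0.
have [N eN] : exists N, N = D * r by exists (D * r).
have bound s t : 0 < s -> 4 * t <= 7 * s -> s <= r ->
    2 ^ s * ('C((3 * N).+1, s) * ('C(3 * N, t) * t ^ (3 * s))) <= N ^ (3 * s).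
  move=> s0 ts sr; apply: union_bound_term => //.
  by rewrite eN leq_mul2l sr orbT.
rewrite -eN in le_rN *; have {D eN} N0 : 0 < N by rewrite (leq_trans r0).
set m := (3 * N).+1.
pose within (S : {set 'I_m}) (U : {set 'I_(3 * N)}) := [set f : {ffun 'I_m * 'I_3 -> 'I_N} |
  [forall e in S, random_eqs f e \subset U]].
(* The value [7 * s %/ 4] bounds the number of variables of [s] equations whose sum violates
   expansion, so every non-expanding system is bad. *)
pose bad := \bigcup_(s < r.+1 | 0 < s) \bigcup_(S : {set 'I_m} | #|S| == s)
  \bigcup_(U : {set 'I_(3 * N)} | #|U| == 7 * s %/ 4) within S U.
have : ~~ ([set: {ffun 'I_m * 'I_3 -> 'I_N}] \subset bad).
  apply/negP=> /subset_leq_card; apply/negP; rewrite -ltnNge;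
  pose a s := 'C(m, s) * ('C(3 * N, 7 * s %/ 4) *
    ((7 * s %/ 4) ^ (3 * s) * N ^ (3 * (m - s)))).
  apply: (@leq_ltn_trans (\sum_(s < r.+1 | 0 < s) a s)).
    apply: leq_trans (card_bigcup_le _ _) _; apply: leq_sum => s _.
    rewrite /a -[X in 'C(X, s)]card_ord -card_draws -sum_nat_const.
    rewrite [X in _ <= X](eq_bigl (fun S : {set 'I_m} => #|S| == s));
      last by move=> S; rewrite inE.
    apply: leq_trans (card_bigcup_le _ _) _; apply: leq_sum => S /eqP cS.
    rewrite -[X in 'C(X, _)]card_ord -card_draws -sum_nat_const.
    rewrite [X in _ <= X](eq_bigl (fun U : {set 'I_(3 * N)} => #|U| == 7 * s %/ 4));
      last by move=> U; rewrite inE.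
    apply: leq_trans (card_bigcup_le _ _) _; apply: leq_sum => U /eqP cU.
    by rewrite -cU -cS; exact: card_eqs_within.
  rewrite cardsT card_ffun card_prod !card_ord.
  rewrite -(big_mkord (fun s => 0 < s) a) big_ltn_cond //=.
  rewrite big_nat_cond (eq_bigl (fun s => 0 < s < r.+1)) => [|s]; last by lia.
  rewrite -big_nat; apply: geometric_sum_lt => [|s s0 sr]; first by rewrite expn_gt0 N0.
  have -> : m * 3 = 3 * s + 3 * (m - s) by rewrite /m; lia.
  have := leq_mul (bound s (7 * s %/ 4) s0 _ sr) (leqnn (N ^ (3 * (m - s)))).
  by rewrite -!mulnA expnD; apply; rewrite mulnC; exact: leq_divM.
case/subsetPn=> f _ fgood; exists (random_eqs f); split=> [e|S S0 Sr].
  exact: card_random_eqs.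
rewrite ltnNge; apply: contra fgood => supS.
have := card_cover_odd_support S (card_random_eqs f) => cover.
have [||U sU cU] := @superset_of_card _ (\bigcup_(e in S) random_eqs f e) (7 * #|S| %/ 4).
- by rewrite leq_divRL; lia.
- by rewrite card_ord; lia.
apply/bigcupP; exists (inord #|S|); rewrite inordK // ?card_gt0 //.
apply/bigcupP; exists S => //; apply/bigcupP; exists U; first by rewrite cU.
rewrite inE; apply/forall_inP=> e eS.
exact: subset_trans (bigcup_sup e eS) sU.
Qed.

(** * Parity formulas *)

Lemma addb_sum_odd (I : finType) (S : {set I}) (P : pred I) :
  \big[addb/false]_(i in S) P i = odd #|[set i in S | P i]|.
Proof.
rewrite -sum1_card (big_morph odd oddD (erefl _)) [RHS]big_mkcond [LHS]big_mkcond.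
by apply: eq_bigr => i _; rewrite inE; case: (i \in S); case: (P i).
Qed.

Definition symdiff (T : finType) (S S' : {set T}) := (S :\: S') :|: (S' :\: S).

Lemma addb_sum_symdiff (I : finType) (S S' : {set I}) (F : pred I) :
  \big[addb/false]_(i in symdiff S S') F i
  = (\big[addb/false]_(i in S) F i) (+) (\big[addb/false]_(i in S') F i).
Proof.
rewrite [LHS]big_mkcond [X in X (+) _]big_mkcond [X in _ (+) X]big_mkcond -big_split.
by apply: eq_bigr => i _; rewrite !inE /=; do 2!case: (i \in _); case: (F i).
Qed.

Lemma card_symdiff (T : finType) (S S' : {set T}) : #|symdiff S S'| <= #|S| + #|S'|.
Proof.
by rewrite (leq_trans (leq_card_setU _ _)) // leq_add // subset_leq_card ?subsetDl.
Qed.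

Lemma odd_support_symdiff (E V : finType) (A : E -> {set V}) (S S' : {set E}) v :
  v \in odd_support A (symdiff S S')
  = (v \in odd_support A S) (+) (v \in odd_support A S').
Proof. by rewrite !inE -!addb_sum_odd addb_sum_symdiff. Qed.

Section Literals.

Variable nv : nat.
Local Notation V := 'I_nv.
Implicit Types (B : {set V}) (g h : V -> bool) (f : cnf nv) (l : lit nv).

(** The left-hand side over F_2 of the equation with variable set [B], evaluated at [g]. *)
Definition par B g := \big[addb/false]_(v in B) g v.

Lemma eq_par B g h : {in B, g =1 h} -> par B g = par B h.
Proof. exact: eq_bigr. Qed.

Lemma parD B g h : par B (fun v => g v (+) h v) = par B g (+) par B h.
Proof. exact: big_split. Qed.

(** This clause fails exactly for the assignments that equal the negation of [h] on [B]. *)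
Definition clause B h : {set lit nv} := [set l | (l.1 \in B) && (l.2 == h l.1)].

Lemma card_clause B h : #|clause B h| = #|B|.
Proof.
rewrite -(card_imset (f := fun v => (v, h v) : lit nv)); last by move=> v v' [].
congr #|pred_of_set _|; apply/setP=> -[v a]; rewrite !inE /=.
apply/andP/imsetP=> [[vB /eqP->]|[w wB [-> ->]]]; first by exists v.
by rewrite wB eqxx.
Qed.

Lemma eq_clause B g h : {in B, g =1 h} -> clause B g = clause B h.
Proof.
by move=> gh; apply/setP=> -[v a]; rewrite !inE /=; case: (boolP (v \in B)) => //= /gh->.
Qed.

Definition flip g l : lit nv := (l.1, l.2 (+) g l.1).

Lemma flipK g : involutive (flip g).
Proof. by case=> v a; rewrite /flip /= addbK. Qed.

Lemma flip_inj g : injective (flip g).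
Proof. exact/inv_inj/flipK. Qed.

Lemma flip_clause g B h : flip g @: clause B h = clause B (fun v => h v (+) g v).
Proof.
apply/setP=> l; rewrite -[l in LHS](flipK g) (mem_imset _ _ (@flip_inj g)) !inE /=.
by case: l => v a /=; case: a; case: (h v); case: (g v).
Qed.

Definition vars f (u : LCN_V f) : {set V} :=
  match u with inl l => [set l.1] | inr c => [set l.1 | l in val c] end.

Lemma vars_clause B h : [set l.1 | l in clause B h] = B.
Proof.
apply/setP=> v; apply/imsetP/idP=> [[l]|vB]; first by rewrite inE => /andP[? _] ->.
by exists (v, h v); rewrite // inE /= vB eqxx.
Qed.

(** A relation and not a map, because the image of a clause of [f] under the flip need not be a
    clause of [f']. *)
Definition flipped f f' g (u : LCN_V f) (w : LCN_V f') : bool :=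
  match u, w with
  | inl l, inl l' => l' == flip g l
  | inr c, inr c' => val c' == flip g @: val c
  | _, _ => false
  end.

Lemma flipped_vars f f' g (u : LCN_V f) (w : LCN_V f') :
  flipped g u w -> vars w = vars u.
Proof.
case: u w => [l|c] [l'|c'] //= /eqP->; first by [].
by rewrite -imset_comp.
Qed.

(** A vertex sees [g] only on its own variables, which lets Duplicator change the flip elsewhere. *)
Lemma eq_flipped f f' g h (u : LCN_V f) (w : LCN_V f') :
  {in vars u, g =1 h} -> flipped g u w = flipped h u w.
Proof.
case: u w => [l|c] [l'|c'] //= gh.
  by rewrite /flip gh ?inE.
rewrite (eq_in_imset (g := flip h)) // => l lc.
by rewrite /flip gh ?imset_f.
Qed.

Lemma flipped_eq f f' g (u u' : LCN_V f) (w w' : LCN_V f') :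
  flipped g u w -> flipped g u' w' -> (u == u') = (w == w').
Proof.
case: u w u' w' => [l|c] [l'|c'] // [m|d] [m'|d'] //= /eqP ew /eqP ew'.
  rewrite -[LHS]/(l == m) -[RHS]/(l' == m') ew ew'.
  by rewrite (inj_eq (@flip_inj g)).
rewrite -[LHS]/(c == d) -[RHS]/(c' == d'); apply/eqP/eqP=> [cd|cd'].
  by apply: val_inj; rewrite /= ew ew' cd.
by apply/val_inj/(imset_inj (@flip_inj g)); rewrite /= -ew -ew' cd'.
Qed.

Lemma flipped_edge f f' g (u u' : LCN_V f) (w w' : LCN_V f') :
  flipped g u w -> flipped g u' w' -> LCN_edge u u' = LCN_edge w w'.
Proof.
case: u w u' w' => [l|c] [l'|c'] // [m|d] [m'|d'] //= /eqP ew /eqP ew'.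
- rewrite ew ew' /=; case: eqP => //= ->.
  by case: l.2; case: m.2; case: (g _).
- by rewrite ew ew' (mem_imset _ _ (@flip_inj g)).
- by rewrite ew ew' (mem_imset _ _ (@flip_inj g)).
Qed.

End Literals.

Section XorCnf.

Variables (nv : nat) (E : finType) (A : E -> {set 'I_nv}).
Hypothesis cardA : forall e, #|A e| = 3.
Local Notation V := 'I_nv.
Implicit Types (b : E -> bool) (g h : V -> bool).

(** A clause excludes the negation of its signs. As [A e] has three elements, negation changes the
    parity, so signs of parity [b e] exclude the assignments of wrong parity. *)
Definition xor_cnf b : cnf nv :=
  \bigcup_e [set clause (A e) (fun v => v \in T) | T : {set V} in
    [set T : {set V} in powerset (A e) | par (A e) (fun v => v \in T) == b e]].

Lemma xor_cnfP b c :
  reflect (exists e h, c = clause (A e) h /\ par (A e) h = b e) (c \in xor_cnf b).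
Proof.
apply: (iffP bigcupP) => [[e _ /imsetP[T]]|[e [h [-> hb]]]].
  by rewrite inE => /andP[_ /eqP Tb] ->; exists e, (fun v => v \in T).
exists e => //; pose T := [set v in A e | h v].
have hT : {in A e, h =1 (fun v => v \in T)} by move=> v vA; rewrite inE vA.
apply/imsetP; exists T; last exact: eq_clause.
by rewrite !inE -(eq_par hT) hb eqxx andbT; apply/subsetP=> v; rewrite inE => /andP[].
Qed.

Lemma xor_cnf_3SAT b : is_3SAT (xor_cnf b).
Proof. by move=> c /xor_cnfP[e [h [-> _]]]; rewrite card_clause cardA. Qed.

Lemma card_xor_cnf b : #|xor_cnf b| <= 8 * #|E|.
Proof.
apply: leq_trans (card_bigcup_le _ _) _.
rewrite mulnC -sum_nat_const; apply: leq_sum => e _.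
apply: leq_trans (leq_imset_card _ _) _.
apply: (@leq_trans #|powerset (A e)|); last by rewrite card_powerset cardA.
by apply/subset_leq_card/subsetP=> T; rewrite inE => /andP[].
Qed.

Lemma par_negb e h : par (A e) (fun v => ~~ h v) = ~~ par (A e) h.
Proof.
rewrite (eq_par (h := fun v => true (+) h v)) // parD -[RHS]addTb; congr (_ (+) _).
rewrite /par (addb_sum_odd _ (fun=> true)).
rewrite (_ : [set i in A e | true] = A e) ?cardA //.
by apply/setP=> v; rewrite inE andbT.
Qed.

Lemma satisfies_xor_cnf b (a : {ffun V -> bool}) :
  (forall c, c \in xor_cnf b -> exists2 l, l \in c & lit_true a l) <->
  (forall e, par (A e) a = b e).
Proof.
split=> [sat e|sol c /xor_cnfP[e [h [-> hb]]]].
  apply/eqP/negP=> /negP neq.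
  (* If [a] violates equation [e], the clause with all signs opposite to [a] belongs to the formula
     and is falsified by [a]. *)
  have [|l] := sat (clause (A e) (fun v => ~~ a v)).
    apply/xor_cnfP; exists e, (fun v => ~~ a v); split=> //.
    by rewrite par_negb; case: (par _ _) (b e) neq => [] [].
  by rewrite inE /lit_true => /andP[_ /eqP->]; case: (a _).
have [v vA hv] : exists2 v, v \in A e & a v == h v.
  apply/exists_inP; apply: contraT => /exists_inPn diff.
  have : par (A e) h = ~~ par (A e) a.
    by rewrite -par_negb; apply: eq_par => v /diff; case: (a v); case: (h v).
  by rewrite sol hb; case: (b e).
by exists (v, h v); rewrite /lit_true // inE /= vA eqxx.
Qed.

End XorCnf.

(** * Duplicator's strategy *)

Section Strategy.

Variables (nv : nat) (E : finType) (A : E -> {set 'I_nv}) (K : nat).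
Hypothesis cardA : forall e, #|A e| = 3.
Hypothesis expanding : forall S, S != set0 -> #|S| <= 4 * K ->
  #|S| < 2 * #|odd_support A S|.
Variables b1 b2 : E -> bool.
Local Notation V := 'I_nv.
Implicit Types (S : {set E}) (X Y : {set V}) (g h : V -> bool).

(** Vanishes when [g] solves equation [e] for the right-hand side [b1 (+) b2], that is, when the
    flip by [g] exchanges the clauses of [e] for [b1] and for [b2]. *)
Definition defect g (e : E) := (b1 e (+) b2 e) (+) par (A e) g.

(* On X, the total function g stands for a partial assignment that satisfies the
   sum of every small set of equations whose variables lie in X. *)
Definition good g X := forall S, #|S| <= 2 * K -> odd_support A S \subset X ->
  \big[addb/false]_(e in S) defect g e = false.

Lemma good_sub g X Y : X \subset Y -> good g Y -> good g X.
Proof. by move=> XY gY S small suppS; apply: gY (subset_trans suppS XY). Qed.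

(** By expansion, only the empty set among the small ones has empty odd support. *)
Lemma good0 g : good g set0.
Proof.
move=> S small; rewrite subset0 => /eqP supp0.
suff -> : S = set0 by rewrite big_set0.
apply/eqP; apply: contraT => S0.
by have := expanding S0 (leq_trans small (leq_mul (isT : 2 <= 4) (leqnn K))); rewrite supp0 cards0.
Qed.

Lemma sum_defect_toggle g v S :
  \big[addb/false]_(e in S) defect (fun w => g w (+) (w == v)) e
  = (\big[addb/false]_(e in S) defect g e) (+) (v \in odd_support A S).
Proof.
rewrite inE -addb_sum_odd -big_split; apply: eq_bigr => e _ /=.
rewrite /defect parD addbA; congr (_ (+) _).
rewrite /par (addb_sum_odd _ (pred1 v)) (_ : [set _ in _ | _] = A e :&: [set v]).
  case: (boolP (v \in A e)) => vA; first by rewrite (setIidPr _) ?sub1set // cards1.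
  by rewrite disjoint_setI0 ?cards0 // disjoint_sym disjoints1.
by apply/setP=> w; rewrite !inE.
Qed.

(** A small set whose sum contains [v] prescribes the new value, and any two such sets prescribe the
    same one; if there is none, the old value stays. *)
Lemma good_extend1 g X v : good g X -> #|v |: X| <= K ->
  exists2 h, {in X, h =1 g} & good h (v |: X).
Proof.
move=> gX leK; case: (boolP (v \in X)) => [vX|vX].
  by exists g => //; rewrite (setUidPr _) ?sub1set.
pose forces S := [&& #|S| <= 2 * K, odd_support A S \subset v |: X & v \in odd_support A S].
have subX S : odd_support A S \subset v |: X -> v \notin odd_support A S ->
    odd_support A S \subset X.
  move=> /subsetP sub vS; apply/subsetP=> w wS; have := sub w wS.
  by rewrite !inE; case: eqP => // ew; rewrite ew (negPf vS) in wS.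
case: (pickP forces) => [S0 /and3P[small0 supp0 v0]|noforce]; last first.
  exists g => // S small supp; apply: gX (small) _; apply: subX => //.
  by apply: contraFN (noforce S) => vS; rewrite /forces small supp.
have agree S : forces S ->
    \big[addb/false]_(e in S) defect g e = \big[addb/false]_(e in S0) defect g e.
  case/and3P=> small supp vS; apply/eqP/negPn.
  rewrite negb_eqb -addb_sum_symdiff; apply/negbT.
  have supp_sub : odd_support A (symdiff S S0) \subset v |: X.
    apply/subsetP=> w; rewrite odd_support_symdiff => wS.
    case: (boolP (w \in odd_support A S)) => [/(subsetP supp)//|wn].
    by move: wS; rewrite (negPf wn) => /(subsetP supp0).
  apply: gX; last by apply: subX; rewrite // odd_support_symdiff vS v0.
  (* The difference of two sets of size at most [2 * K] has at most [4 * K] equations, so expansion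
     applies. Its sum has at most [K] variables, which brings its size below [2 * K], and [good]
     applies again. *)
  have [->|ne0] := eqVneq (symdiff S S0) set0; first by rewrite cards0.
  have := expanding ne0; have := card_symdiff S S0; have := subset_leq_card supp_sub.
  lia.
(* [d] records whether [S0] requires the value at [v] to be toggled. *)
pose d := \big[addb/false]_(e in S0) defect g e.
exists (fun w => g w (+) (d && (w == v))) => [w wX|S small supp].
  case: eqP => [ew|_]; last by rewrite andbF addbF.
  by rewrite -ew wX in vX.
have -> : \big[addb/false]_(e in S) defect (fun w => g w (+) (d && (w == v))) e
    = (\big[addb/false]_(e in S) defect g e) (+) (d && (v \in odd_support A S)).
  case: (d) => /=; first exact: sum_defect_toggle.
  by rewrite addbF; apply: eq_bigr => e _; congr (_ (+) _); apply: eq_par => w; rewrite addbF.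
case: (boolP (v \in odd_support A S)) => vS; last by rewrite andbF addbF gX ?subX.
by rewrite andbT agree ?addbb // /forces small supp.
Qed.

Lemma good_extend g X Y : good g X -> #|X :|: Y| <= K ->
  exists2 h, {in X, h =1 g} & good h (X :|: Y).
Proof.
move: {2}#|Y| (leqnn #|Y|) => n; elim: n g X Y => [|n IH] g X Y.
  by rewrite leqn0 cards_eq0 => /eqP->; rewrite setU0; exists g.
have [->|[v vY]] := set_0Vmem Y; first by rewrite setU0; exists g.
rewrite (cardsD1 v) vY => leY gX leK.
have eXY : (v |: X) :|: (Y :\ v) = X :|: Y.
  by apply/setP=> w; rewrite !inE; case: eqP => [->|]; rewrite ?vY ?orbT.
have [|h hg hX] := good_extend1 (v := v) gX.
  by apply: leq_trans leK; rewrite -eXY subset_leq_card // subsetUl.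
have [|h' hh' h'X] := IH h _ (Y :\ v) leY hX; first by rewrite eXY.
by rewrite eXY in h'X; exists h' => // w wX; rewrite hh' ?hg // inE wX orbT.
Qed.

Lemma good_defect g e X : 0 < K -> good g X -> A e \subset X -> defect g e = false.
Proof.
move=> K0 gX AX; have := gX [set e]; rewrite big_set1; apply; first by rewrite cards1; lia.
apply/subsetP=> v; rewrite inE -addb_sum_odd big_set1; exact: (subsetP AX).
Qed.

Local Notation f1 := (xor_cnf A b1).
Local Notation f2 := (xor_cnf A b2).
Local Notation U := (UV (LCN f1) (LCN f2)).

Definition uvars (u : U) : {set V} :=
  match u with inl a => vars a | inr a => vars a end.

Definition uflipped g (u w : U) : bool :=
  match u, w with
  | inl a, inr a' => flipped g a a'
  | inr a, inl a' => flipped g a a'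
  | _, _ => false
  end.

Lemma card_vars b (u : LCN_V (xor_cnf A b)) : #|vars u| <= 3.
Proof.
case: u => [l|[c /= /xor_cnfP[e [h [-> _]]]]]; first by rewrite cards1.
by rewrite vars_clause cardA.
Qed.

Lemma card_uvars u : #|uvars u| <= 3.
Proof. by case: u => u; apply: card_vars. Qed.

Lemma uflipped_side g u w : uflipped g u w -> in_left w = ~~ in_left u.
Proof. by case: u w => [u|u] [w|w]. Qed.

Lemma uflipped_vars g u w : uflipped g u w -> uvars w = uvars u.
Proof. by case: u w => [u|u] [w|w] //= /flipped_vars. Qed.

Lemma eq_uflipped g h u w : {in uvars u, g =1 h} -> uflipped g u w = uflipped h u w.
Proof. by case: u w => [u|u] [w|w] //= gh; apply: eq_flipped. Qed.

(** A clause shows the variable set of its equation but not the equation, so the hypothesis covers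
    every equation with that set. *)
Lemma flipped_ex b b' g (u : LCN_V (xor_cnf A b)) :
  (forall e, A e = vars u -> (b e (+) b' e) (+) par (A e) g = false) ->
  exists w : LCN_V (xor_cnf A b'), flipped g u w.
Proof.
case: u => [l _|[c /= cf] sol]; first by exists (inl (flip g l)); rewrite /= eqxx.
have [e [h [ec hb]]] := xor_cnfP _ _ _ cf.
suff cf' : flip g @: c \in xor_cnf A b'.
  by exists (inr (exist (fun c => c \in xor_cnf A b') _ cf')); rewrite /= eqxx.
apply/xor_cnfP; exists e, (fun v => h v (+) g v); split; first by rewrite ec flip_clause.
have := sol e; rewrite ec vars_clause => /(_ erefl); rewrite parD hb.
by case: (b e) (b' e) (par _ _) => [] [] [].
Qed.

Lemma uflipped_ex g X u : 0 < K -> good g X -> uvars u \subset X ->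
  exists w, uflipped g u w.
Proof.
move=> K0 gX; case: u => u /= uX.
  have [e eA|w uw] := @flipped_ex b1 b2 g u; last by exists (inr w).
  by apply: (good_defect K0 gX); rewrite eA.
have [e eA|w uw] := @flipped_ex b2 b1 g u; last by exists (inl w).
(* The defect is symmetric in [b1] and [b2], so the same kind of flip serves in both directions. *)
by rewrite [b2 e (+) _]addbC; apply: (good_defect K0 gX); rewrite eA.
Qed.

(** The flip may depend on the side, since vertices of different graphs are never equal and
    [uflipped] always changes the side. *)
Lemma uflipped_eq (g : bool -> V -> bool) u u' w w' :
  uflipped (g (in_left u)) u w -> uflipped (g (in_left u')) u' w' ->
  (u == u') = (w == w').
Proof.
by case: u u' w w' => [u|u] [u'|u'] [w|w] [w'|w'] //= uw uw'; apply: flipped_eq uw uw'.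
Qed.

Lemma uflipped_ecolU (g : bool -> V -> bool) u u' w w' :
  uflipped (g (in_left u)) u w -> uflipped (g (in_left u')) u' w' ->
  ecolU u u' = ecolU w w'.
Proof.
by case: u u' w w' => [u|u] [u'|u'] [w|w] [w'|w'] //= uw uw'; apply: flipped_edge uw uw'.
Qed.

Variable k : nat.
Hypothesis leK : 3 * k <= K.
Local Notation ktuple := (ktuple k (LCN f1) (LCN f2)).
Implicit Types (x y : ktuple) (P : pred 'I_k).

Definition pebbled (P : pred 'I_k) x side : {set V} :=
  \bigcup_(i | P i && (in_left (x i) == side)) uvars (x i).

Lemma sub_pebbled P x i : P i -> uvars (x i) \subset pebbled P x (in_left (x i)).
Proof.
by move=> Pi; apply: (bigcup_sup (F := fun i => uvars (x i)) i); rewrite Pi /=.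
Qed.

Lemma pebbled_sub P x side X :
  (forall i, P i -> in_left (x i) = side -> uvars (x i) \subset X) ->
  pebbled P x side \subset X.
Proof. by move=> h; apply/bigcupsP=> i /andP[Pi /eqP]; apply: h. Qed.

Lemma card_pebbled P x side : #|pebbled P x side| <= 3 * #|P|.
Proof.
apply: leq_trans (card_bigcup_le _ _) _; rewrite mulnC -sum_nat_const big_mkcondr /=.
by apply: leq_sum => i _; case: ifP => // _; apply: card_uvars.
Qed.

(* The tuples live in the disjoint union, so each of the two graphs carries its
   own flip. *)
Definition invariant x y := exists g : bool -> V -> bool,
  (forall side, good (g side) (pebbled predT x side)) /\
  (forall i, uflipped (g (in_left (x i))) (x i) (y i)).

Lemma invariant_atp x y : invariant x y -> same_atp x y.
Proof.
move=> [g [_ xy]]; apply/forallP=> i; apply/forallP=> j.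
by rewrite (uflipped_eq (xy i) (xy j)) (uflipped_ecolU (xy i) (xy j)) !eqxx.
Qed.

(** With pebble [i] lifted, the flip on the side of [u] is kept on the variables still pebbled there
    and extended to those of [u]; then [s u] is the image of [u]. *)
Lemma invariant_step x y i : invariant x y -> exists2 s : U -> U,
  injective s /\ (forall u, in_left (s u) = ~~ in_left u) &
  forall u, invariant (upd x i u) (upd y i (s u)).
Proof.
move=> [g [g_good xy]]; pose Y side := pebbled (predC1 i) x side.
have k0 : 0 < k by apply: leq_ltn_trans (ltn_ord i).
have K0 : 0 < K by lia.
have YX side : Y side \subset pebbled predT x side.
  by apply: pebbled_sub => j _ <-; apply: sub_pebbled.
(* The extension is chosen once for each side and variable set, so vertices with the same variables
   on the same side share a flip; injectivity of [s] rests on this. *)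
have ext (p : bool * {set V}) : exists h, #|p.2| <= 3 ->
    {in Y p.1, h =1 g p.1} /\ good h (Y p.1 :|: p.2).
  have [le3|] := leqP #|p.2| 3; last by exists (g p.1).
  have [|h hg hgood] := @good_extend (g p.1) (Y p.1) p.2 (good_sub (YX _) (g_good _)).
    apply: leq_trans (leq_card_setU _ _) _.
    (* The [k - 1] remaining pebbles show at most [3 * (k - 1)] variables and the moved one at most
       three. *)
    have := card_pebbled (predC1 i) x p.1; rewrite -/(Y _) cardC1 card_ord; lia.
  by exists h.
have [G /= GP] := fin_all_exists ext.
pose Gu u := G (in_left u, uvars u).
have GuP u := GP (in_left u, uvars u) (card_uvars u).
have [s sP] : exists s : U -> U, forall u, uflipped (Gu u) u (s u).
  apply: (fin_all_exists (P := fun u w => uflipped (Gu u) u w)) => u.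
  by apply: uflipped_ex K0 (GuP u).2 _; apply: subsetUr.
have s_inj (u u' : U) : s u = s u' -> u = u'.
  move=> suu'; have := sP u'; rewrite -suu' => su'.
  (* The vertex [s u] determines the side and the variables of [u], hence the flip that was used. *)
  have eGu : Gu u = Gu u'.
    rewrite /Gu -(uflipped_vars (sP u)) -(uflipped_vars su').
    by rewrite -[in_left u]negbK -[in_left u']negbK -(uflipped_side (sP u)) -(uflipped_side su').
  have su := sP u; rewrite eGu in su.
  by apply/eqP; rewrite (uflipped_eq (g := fun=> Gu u') su su').
have s_side (u : U) : in_left (s u) = ~~ in_left u by apply: uflipped_side (sP u).
suff s_inv (u : U) : invariant (upd x i u) (upd y i (s u)) by exists s.
exists (fun side => if side == in_left u then Gu u else g side); split=> [side|j].
  case: eqP => [->|/eqP ne].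
    apply: good_sub (GuP u).2; apply: pebbled_sub => j _; rewrite ffunE.
    case: (j =P i) => [_ _|/eqP ji <-]; first exact: subsetUr.
    by apply: subset_trans (subsetUl _ _); apply: sub_pebbled; rewrite /= ji.
  apply: good_sub (g_good side); apply: pebbled_sub => j _; rewrite ffunE.
  case: (j =P i) => [_ su|_ <-]; first by rewrite su eqxx in ne.
  exact: sub_pebbled.
rewrite !ffunE; case: (j =P i) => [_|/eqP ji]; first by rewrite eqxx; apply: sP.
case: eqP => [sj|_]; last exact: xy.
(* A pebble left on the side of [u] keeps its partner, as the new flip agrees with the old one on
   its variables. *)
rewrite (eq_uflipped (h := g (in_left (x j)))) ?xy // => v vj.
rewrite sj; apply: (GuP u).1; rewrite /= -sj.
by apply: subsetP vj; apply: sub_pebbled.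
Qed.

(** All pebbles start on one literal, so the flip has to be good on a single variable only. *)
Lemma invariant_ex : 0 < k -> 0 < nv -> exists x y, invariant x y.
Proof.
move=> k0 nv0; pose v0 := Ordinal nv0; pose l : lit nv := (v0, false).
have [|h _ hgood] := good_extend1 (v := v0) (@good0 xpredT).
  by rewrite setU0 cards1; lia.
exists [ffun=> inl (inl l)], [ffun=> inr (inl (flip h l))], (fun=> h); split=> [side|i].
  by apply: good_sub hgood; apply: pebbled_sub => i _ _; rewrite ffunE setU0.
by rewrite !ffunE /=.
Qed.

Lemma xor_cnf_indistinguishable : 0 < k -> 0 < nv ->
  wl_indistinguishable k (LCN f1) (LCN f2).
Proof.
move=> k0 nv0; apply: back_and_forth_indistinguishable (invariant_ex k0 nv0).
- exact: invariant_atp.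
- exact: invariant_step.
Qed.

End Strategy.

(** * An unsolvable right-hand side and the final parameters *)

(** The [2 ^ nv] assignments cannot reach all [2 ^ m] right-hand sides. *)
Lemma unsolvable_rhs nv m (A : 'I_m -> {set 'I_nv}) : nv < m ->
  exists b : 'I_m -> bool, forall a : {ffun 'I_nv -> bool},
    ~ (forall e, par (A e) a = b e).
Proof.
move=> lt_nm; pose img (a : {ffun 'I_nv -> bool}) : {ffun 'I_m -> bool} :=
  [ffun e => par (A e) a].
have : ~~ ([set: {ffun 'I_m -> bool}] \subset img @: setT).
  apply/negP=> /subset_leq_card; apply/negP; rewrite -ltnNge.
  apply: leq_ltn_trans (leq_imset_card _ _) _.
  by rewrite !cardsT !card_ffun !card_ord card_bool ltn_exp2l.
case/subsetPn=> b _ bn; exists b => a ab; case/imsetP: bn; exists a => //.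
by apply/ffunP=> e; rewrite ffunE ab.
Qed.

Theorem theorem2 :
  exists C : rat, (0 < C)%R /\
  forall n : nat, 0 < n ->
    exists (nv1 : nat) (f : cnf nv1) (nv2 : nat) (f' : cnf nv2),
      [/\ is_3SAT f /\ is_3SAT f',
          (nv1%:R <= C * n%:R)%R /\ (#|f|%:R <= C * n%:R)%R,
          (nv2%:R <= C * n%:R)%R /\ (#|f'|%:R <= C * n%:R)%R,
          satisfiable f /\ ~ satisfiable f'
        & wl_indistinguishable n (LCN f) (LCN f')].
Proof.
have [D D0 systems] := expanding_system.
(* There will be [36 * D * n] variables, one more equation, and at most 8 clauses counted per
   equation: [288 * D * n + 8] clauses, within [384 * D * n]. *)
exists (384 * D)%N%:R%R; split=> [|n n0]; first by rewrite ltr0n muln_gt0 D0.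
(* The strategy runs with [K = 3 * n], three variables per pebble, and needs expansion up to [4 * K]
   equations. *)
have [|A [cardA expA]] := systems (12 * n); first by rewrite muln_gt0.
set nv := 3 * (D * (12 * n)) in A cardA expA.
have nv0 : 0 < nv by rewrite !muln_gt0 D0 n0.
have le_nv : 8 * nv.+1 <= 384 * D * n by rewrite /nv; nia.
have sizes (b : 'I_nv.+1 -> bool) : (nv%:R <= (384 * D)%N%:R * n%:R :> rat)%R /\
    (#|xor_cnf A b|%:R <= (384 * D)%N%:R * n%:R :> rat)%R.
  rewrite -natrM !ler_nat; split; first by lia.
  by apply: leq_trans (card_xor_cnf cardA b) _; rewrite card_ord.
have [b unsolvable] := unsolvable_rhs A (ltnSn nv).
exists nv, (xor_cnf A (fun=> false)), nv, (xor_cnf A b); split=> //.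
- by split; apply: xor_cnf_3SAT.
- split; last by case=> a /(satisfies_xor_cnf cardA); apply: unsolvable.
  exists [ffun=> false]; apply/(satisfies_xor_cnf cardA) => e.
  by rewrite /par big1 // => v _; rewrite ffunE.
- apply: (@xor_cnf_indistinguishable _ _ A (3 * n)) => // S S0.
  by rewrite mulnA; apply: expA.
Qed.
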